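(* Let $\alpha>0$, $A\ge0$, $B>0$, $t>0$, and let $P_n(x,t)$ be the monic polynomials orthogonal on $[0,\infty)$ w.r.t. $w(x,t)=x^\alpha e^{-x}(A+B\theta(x-t))$, with recurrence $zP_n=P_{n+1}+\alpha_n(t)P_n+\beta_n(t)P_{n-1}$. Let $D_n(t)=\det\left(\int_0^\infty x^{i+j}w(x,t)dx\right)_{i,j=0}^{n-1}$ ($D_0=1$) and $H_n(t)=t\frac{d}{dt}\ln D_n(t)$. Then for $n\ge1$ (whenever denominators are nonzero) $$\alpha_n(t)-(2n+\alpha+1)=\frac{t^2H_n''+[(2n+\alpha)t-t^2]H_n'+tH_n}{2[H_n-n(n+\alpha)-tH_n']},\qquad \beta_n(t)-n(n+\alpha)=tH_n'-H_n,$$ where $H_n$ satisfies $$(tH_n'')^2=4(H_n')^2[H_n-n(n+\alpha)-tH_n']+[(2n+\alpha-t)H_n'+H_n]^2;$$ moreover $$\alpha_n(t)-(2n+\alpha+1)=H_n-H_{n+1},\qquad \beta_n(t)-n(n+\alpha)=\frac{H_n(2n+\alpha)-n(n+\alpha)(H_{n+1}-H_{n-1})}{t+H_{n+1}-H_{n-1}-2n-\alpha},$$ and $H_n$ satisfies the difference equation $$\left\{\frac{[H_n-n(n+\alpha)](t+H_{n+1}-H_{n-1})+t\,n(n+\alpha)}{t+H_{n+1}-H_{n-1}-2n-\alpha}\right\}^2=\left\{\frac{(2n+\alpha)[H_n-n(n+\alpha)]+t\,n(n+\alpha)}{t+H_{n+1}-H_{n-1}-2n-\alpha}\right\}(H_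n-H_{n+1})(H_{n-1}-H_n).$$
   Context: $\theta$ is the Heaviside function ($1$ for $x>0$, $0$ otherwise); primes denote $d/dt$. *)

(* Defs.v *)
From Stdlib Require Import Reals.
From Coquelicot Require Import Coquelicot.
From mathcomp Require Import all_boot all_algebra.
From mathcomp Require Import Rstruct.
Local Open Scope R_scope.

Definition heaviside (x : R) : R := if Rlt_dec 0 x then R1 else R0.

(* x^a for x > 0 (value at x <= 0 irrelevant for the integrals; set to 0) *)
Definition xpow (x a : R) : R := if Rlt_dec 0 x then Rpower x a else R0.

Definition weight (al A B t x : R) : R :=
  xpow x al * exp (- x) * (A + B * heaviside (x - t)).

Definition int0inf (f : R -> R) : R :=
  RInt_gen f (at_point R0) (Rbar_locally p_infty).

Definition moment (al A B t : R) (k : nat) : R :=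
  int0inf (fun x => x ^ k * weight al A B t x).

Local Open Scope ring_scope.

Definition hankelD (al A B : R) (n : nat) (t : R) : R :=
  \det (\matrix_(i < n, j < n) moment al A B t (i + j)%N).

Definition Hn (al A B : R) (n : nat) (t : R) : R :=
  t * Derive (fun s => ln (hankelD al A B n s)) t.

Local Open Scope ring_scope.

Definition monic_OPS (al A B t : R) (P : nat -> {poly R}) : Prop :=
  (forall n, P n \is monic /\ size (P n) = n.+1) /\
  (forall m n, m <> n ->
     int0inf (fun x => (P m).[x] * (P n).[x] * weight al A B t x) = R0).

Definition three_term (P : nat -> {poly R}) (a b : nat -> R) : Prop :=
  forall n, (1 <= n)%N ->
    'X * P n = P n.+1 + a n *: P n + b n *: P n.-1.

Local Close Scope ring_scope.

(* Main.v *)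
Require Import Defs.
From Stdlib Require Import Reals Lra.
From Coquelicot Require Import Coquelicot.
From HB Require Import structures.
From mathcomp Require Import all_boot all_order all_algebra.
From mathcomp Require Import Rstruct.

(** Write [L_t p] for the integral of [p] against the weight, [P_n] for its
    monic orthogonal polynomials, [h_n = L_t (P_n ^ 2)] and
    [c = B t^alpha e^(-t)] for the jump of the weight at [t].  Everything
    follows from two properties of the moments: [d mu_k / dt = - c t^k], and
    [mu_(k+1) = (k+1+alpha) mu_k + c t^(k+1)] (integration by parts).  With
    [R_n = t c P_n(t)^2 / h_n] and [r_n = t c P_n(t) P_(n-1)(t) / h_(n-1)],
    integrating by parts against [P_n^2] and [P_n P_(n-1)] gives
    [alpha_n = 2n+1+alpha+R_n] and [beta_n = r_n - p_n], where [p_n] is the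
    subleading coefficient of [P_n].  Since the t-derivative of [P_n] has lower
    degree, [t h_n' = - R_n h_n] and [t p_n' = r_n]; as [D_n] is the product of
    the [h_j], this yields [H_n = - sum_(j<n) R_j = n(n+alpha) + p_n] and
    [t H_n' = r_n].  Finally [r_n^2 = beta_n R_n R_(n-1)] together with
    [beta_n (R_n + R_(n-1)) = (t-2n-alpha) r_n - t H_n] and
    [t beta_n' = beta_n (R_(n-1) - R_n)] determine [R_n] and [R_(n-1)] by their
    sum, product and difference; eliminating them gives all the identities. *)

Local Open Scope R_scope.

(** * Moments of the discontinuous weight *)

Lemma ball_RE (x e y : R) : ball x e y <-> Rabs (y - x) < e.
Proof. by []. Qed.

Lemma xpow_pos x al : 0 < x -> xpow x al = Rpower x al.
Proof. by rewrite /xpow; case: Rlt_dec. Qed.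

Lemma xpow_nonpos x al : x <= 0 -> xpow x al = 0.
Proof. by rewrite /xpow; case: Rlt_dec => // h1 h2; lra. Qed.

Lemma xpow_ge0 x al : 0 <= xpow x al.
Proof.
case: (Rlt_le_dec 0 x) => x0; first by rewrite xpow_pos //; exact/Rlt_le/exp_pos.
by rewrite xpow_nonpos //; lra.
Qed.

(** At the origin [al > 0] is what glues the zero branch to the power. With continuity on all of
    [R], the densities below are integrable on every interval and their primitives differentiable
    everywhere. *)
Lemma continuous_xpow (al x : R) : 0 < al -> continuous (fun y => xpow y al) x.
Proof.
move=> al_gt0; case: (Rtotal_order x 0) => [xlt0 | [-> | xgt0]].
- apply: (continuous_ext_loc _ (fun _ => 0)); last exact: continuous_const.
  exists (mkposreal (- x) (Ropp_0_gt_lt_contravar _ xlt0)) => y.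
  move=> /ball_RE /Rabs_def2 /= [h1 h2].
  by rewrite xpow_nonpos //; lra.
- apply/filterlim_locally => eps; rewrite xpow_nonpos; last lra.
  (* The radius is eps^(1/al): a positive [y] below it satisfies y^al < eps. *)
  have dpos : 0 < Rpower eps (/ al) by apply: exp_pos.
  exists (mkposreal _ dpos) => y /ball_RE /Rabs_def2 /= [h1 _].
  rewrite Rminus_0_r in h1; apply/ball_RE; rewrite Rminus_0_r.
  case: (Rlt_le_dec 0 y) => ygt0; last by rewrite xpow_nonpos // Rabs_R0; apply: cond_pos.
  rewrite xpow_pos //.
  rewrite Rabs_pos_eq; last exact/Rlt_le/exp_pos.
  have -> : pos eps = Rpower (Rpower eps (/ al)) al.
    by rewrite Rpower_mult Rinv_l ?Rpower_1 //; [exact: cond_pos | lra].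
  by apply: Rlt_Rpower_l.
- apply: (continuous_ext_loc _ (fun y => Rpower y al)).
    exists (mkposreal _ xgt0) => y /ball_RE /Rabs_def2 /= [h1 h2].
    by rewrite xpow_pos //; lra.
  apply: ex_derive_continuous; exists (al * Rpower x (al - 1)).
  exact/is_derive_Reals/derivable_pt_lim_power.
Qed.

(** * Gamma densities and their incomplete and complete integrals *)

Definition gamma_density (al : R) (k : nat) (x : R) : R :=
  x ^ k * (xpow x al * exp (- x)).

Lemma continuous_gamma_density al k x :
  0 < al -> continuous (gamma_density al k) x.
Proof.
move=> al_gt0; apply: (continuous_mult (fun y => y ^ k)).
  by apply: ex_derive_continuous; auto_derive.
apply: (continuous_mult (fun y => xpow y al)); first exact: continuous_xpow.
by apply: ex_derive_continuous; auto_derive.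
Qed.

Lemma gamma_density_ge0 al k x : 0 <= x -> 0 <= gamma_density al k x.
Proof.
move=> x_ge0; apply: Rmult_le_pos; first exact: pow_le.
by apply: Rmult_le_pos; [exact: xpow_ge0 | exact/Rlt_le/exp_pos].
Qed.

Lemma gamma_densityE al k x :
  0 < x -> gamma_density al k x = exp ((INR k + al) * ln x - x).
Proof.
move=> x_gt0; rewrite /gamma_density xpow_pos //.
rewrite -Rpower_pow // /Rpower -!exp_plus; f_equal; ring.
Qed.

Lemma gamma_densityS al k x : gamma_density al k.+1 x = x * gamma_density al k x.
Proof. by rewrite /gamma_density /=; ring. Qed.

(** This is ln u <= u - 1 at u = e x; the free slope [e] lets a multiple of ln x be absorbed into a
    chosen fraction of x. *)
Lemma ln_le_affine (e x : R) : 0 < e -> 0 < x -> ln x <= e * x - 1 - ln e.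
Proof.
move=> e_gt0 x_gt0; have ex_gt0 : 0 < e * x by apply: Rmult_lt_0_compat.
have : ln (e * x) <= e * x - 1.
  have := exp_ineq1_le (ln (e * x)); rewrite exp_ln //; lra.
rewrite ln_mult //; lra.
Qed.

Lemma gamma_density_bound al k :
  0 < al -> exists C, 0 < C /\ forall x, 0 <= x -> gamma_density al k x <= C * exp (- x / 2).
Proof.
move=> al_gt0; set s := INR k + al.
have s_gt0 : 0 < s by have := pos_INR k; rewrite /s; lra.
(* With this slope, s ln x costs at most x/2 plus a constant, so half of the decay of e^(-x)
   survives. *)
set e := / (2 * s); have e_gt0 : 0 < e by apply: Rinv_0_lt_compat; lra.
exists (exp (s * (- 1 - ln e))); split=> [|x x_ge0]; first exact: exp_pos.
case: (Rle_lt_or_eq_dec _ _ x_ge0) => [x_gt0 | <-]; last first.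
  rewrite /gamma_density xpow_nonpos; last lra.
  by rewrite Rmult_0_l Rmult_0_r; apply: Rmult_le_pos; apply/Rlt_le/exp_pos.
rewrite gamma_densityE // -exp_plus; apply: Rnot_lt_le => /exp_lt_inv.
have h := Rmult_le_compat_l s _ _ (Rlt_le _ _ s_gt0) (ln_le_affine e x e_gt0 x_gt0).
have se : s * (e * x) = x / 2 by rewrite /e; field; lra.
rewrite -/s; nra.
Qed.

Lemma ex_RInt_gamma_density al k a b : 0 < al -> ex_RInt (gamma_density al k) a b.
Proof. by move=> al_gt0; apply: ex_RInt_continuous => z _; exact: continuous_gamma_density. Qed.

(** For M >= 0 this is the lower incomplete Gamma function at parameter k + al + 1. *)
Definition lower_gamma (al : R) (k : nat) (M : R) : R := RInt (gamma_density al k) 0 M.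

Lemma is_RInt_gamma_density al k a b : 0 < al ->
  is_RInt (gamma_density al k) a b (lower_gamma al k b - lower_gamma al k a).
Proof.
move=> al_gt0; have := is_RInt_Chasles _ _ _ _ _ _
  (is_RInt_swap _ _ _ _ (RInt_correct _ _ _ (ex_RInt_gamma_density al k 0 a al_gt0)))
  (RInt_correct _ _ _ (ex_RInt_gamma_density al k 0 b al_gt0)).
by rewrite /plus /Hierarchy.opp /= -/(lower_gamma al k a) -/(lower_gamma al k b) Rplus_comm.
Qed.

Lemma lower_gamma_incr al k a b : 0 < al -> 0 <= a <= b ->
  lower_gamma al k a <= lower_gamma al k b.
Proof.
move=> al_gt0 [a_ge0 le_ab].
have h := is_RInt_gamma_density al k a b al_gt0.
suff : 0 <= lower_gamma al k b - lower_gamma al k a by lra.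
apply: (is_RInt_le (fun _ => 0) _ _ _ _ _ le_ab _ h) => [|x [h1 h2]].
  by have := is_RInt_const a b (0 : R); rewrite /scal /= /mult /= Rmult_0_r.
by apply: gamma_density_ge0; lra.
Qed.

Lemma is_derive_lower_gamma al k x : 0 < al ->
  is_derive (lower_gamma al k) x (gamma_density al k x).
Proof.
move=> al_gt0; apply: (is_derive_RInt _ _ 0); last exact: continuous_gamma_density.
apply: filter_forall => y; exact/RInt_correct/ex_RInt_gamma_density.
Qed.

(** The limit is the supremum of the values on [0, +oo), the only region where monotonicity is
    assumed. *)
Lemma monotone_bounded_is_lim (f : R -> R) (C : R) :
  (forall a b, 0 <= a <= b -> f a <= f b) -> (forall a, 0 <= a -> f a <= C) ->
  exists l : R, is_lim f p_infty l.
Proof.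
move=> f_incr f_bnd.
pose E y := exists x, 0 <= x /\ f x = y.
have [l [l_ub l_lub]] : {l | Raxioms.is_lub E l}.
  apply: completeness; first by exists C => y [x [x_ge0 <-]]; exact: f_bnd.
  by exists (f 0), 0; split => //; lra.
exists l; apply/is_lim_spec => eps.
have [x [x_ge0 fx]] : exists x, 0 <= x /\ l - eps < f x.
  apply: Classical_Pred_Type.not_all_not_ex => hall.
  have : l <= l - eps.
    apply: l_lub => y [x [x_ge0 <-]]; apply: Rnot_lt_le => h; exact: (hall x).
  by have := cond_pos eps; lra.
exists x => y ltxy; have := f_incr x y ltac:(lra).
have : f y <= l by apply: l_ub; exists y; split => //; lra.
by move=> h1 h2; apply: Rabs_def1; lra.
Qed.

(** The bound [2 * C] is the full integral over [0, +oo) of the majorant C e^(-x/2). *)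
Lemma ex_lim_lower_gamma al k : 0 < al ->
  exists l : R, is_lim (lower_gamma al k) p_infty l.
Proof.
move=> al_gt0; have [C [C_gt0 hC]] := gamma_density_bound al k al_gt0.
apply: (@monotone_bounded_is_lim _ (2 * C)) => [a b | a a_ge0]; first exact: lower_gamma_incr.
have h : is_RInt (fun x => C * exp (- x / 2)) 0 a (2 * C - 2 * C * exp (- a / 2)).
  have -> : 2 * C - 2 * C * exp (- a / 2) =
    minus (- 2 * C * exp (- a / 2)) (- 2 * C * exp (- 0 / 2)).
    by rewrite /minus /plus /Hierarchy.opp /= Ropp_0 /Rdiv Rmult_0_l exp_0; ring.
  apply: (is_RInt_derive (fun x => - 2 * C * exp (- x / 2))) => x _.
    by auto_derive => //; rewrite /Rdiv; lra.
  by apply: ex_derive_continuous; auto_derive.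
have hle x : 0 < x < a -> gamma_density al k x <= C * exp (- x / 2).
  by move=> [h1 h2]; apply: hC; lra.
have := is_RInt_le _ _ _ _ _ _ a_ge0 (is_RInt_gamma_density al k 0 a al_gt0) h hle.
have -> : lower_gamma al k 0 = 0 by rewrite /lower_gamma RInt_point.
by have := exp_pos (- a / 2); nra.
Qed.

(** This is Gamma(k + al + 1). [real] discards no information when [al > 0], the limit then being
    finite. *)
Definition complete_gamma (al : R) (k : nat) : R := real (Lim (lower_gamma al k) p_infty).

Lemma is_lim_lower_gamma al k : 0 < al ->
  is_lim (lower_gamma al k) p_infty (complete_gamma al k).
Proof.
by move=> al_gt0; case: (ex_lim_lower_gamma al k al_gt0) => l hl;
   rewrite /complete_gamma (is_lim_unique _ _ _ hl).
Qed.

(** This kills the boundary term at infinity when integrating by parts. *)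
Lemma is_lim_gamma_density al k : 0 < al -> is_lim (gamma_density al k) p_infty 0.
Proof.
move=> al_gt0; have [C [C_gt0 hC]] := gamma_density_bound al k al_gt0.
have expl : is_lim (fun x => C * exp (- x / 2)) p_infty 0.
  have -> : Rbar.Finite 0 = Rbar_mult (Rbar.Finite C) (Rbar.Finite 0) by rewrite /= Rmult_0_r.
  apply: is_lim_scal_l; apply: (is_lim_comp exp (fun x => - x / 2) p_infty 0 m_infty).
  - exact: is_lim_exp_m.
  - apply: (is_lim_ext (fun x => (- / 2) * x)) => [x|]; first by field.
    have -> : m_infty = Rbar_mult (- / 2) p_infty.
      by rewrite Rbar_mult_comm (is_Rbar_mult_unique _ _ _ (is_Rbar_mult_p_infty_neg (Rbar.Finite (- / 2)) _)) //=; lra.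
    by apply: is_lim_scal_l; exact: is_lim_id.
  - by exists 0.
apply: (is_lim_le_le_loc (fun _ => 0) (fun x => C * exp (- x / 2))) => //.
- exists 0 => x x_gt0; split; first by apply: gamma_density_ge0; lra.
  by apply: hC; lra.
- exact: is_lim_const.
Qed.

Lemma is_derive_gamma_densityS al k x : 0 < x ->
  is_derive (gamma_density al k.+1) x
    ((INR k + 1 + al) * gamma_density al k x - gamma_density al k.+1 x).
Proof.
move=> x_gt0.
apply: (is_derive_ext_loc (fun y => exp ((INR k.+1 + al) * ln y - y))).
  exists (mkposreal _ x_gt0) => y /ball_RE /Rabs_def2 /= [h1 h2].
  by rewrite gamma_densityE //; lra.
have -> : (INR k + 1 + al) * gamma_density al k x - gamma_density al k.+1 x =
  ((INR k.+1 + al) / x - 1) * exp ((INR k.+1 + al) * ln x - x).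
  rewrite -gamma_densityE // gamma_densityS S_INR; field; lra.
by move: (INR k.+1 + al) => s; auto_derive => //; rewrite /Rminus; field; lra.
Qed.

(** Integration by parts, obtained by showing that the difference [f] of the two sides vanishes at 0
    and has zero derivative on (0, M). *)
Lemma lower_gammaS al k M : 0 < al -> 0 <= M ->
  lower_gamma al k.+1 M =
    (INR k + 1 + al) * lower_gamma al k M - gamma_density al k.+1 M.
Proof.
move=> al_gt0 M_ge0.
pose f x := lower_gamma al k.+1 x - (INR k + 1 + al) * lower_gamma al k x
            + gamma_density al k.+1 x.
(* Only the interior derivative is needed, so nothing is claimed at [x = 0]. *)
have [x | x _ | c [_ fM]] := MVT_gen f 0 M (fun _ => 0).
- rewrite Rmin_left // => -[x_gt0 _].
  have -> : 0 = plus (minus (gamma_density al k.+1 x)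
     ((INR k + 1 + al) * gamma_density al k x))
    ((INR k + 1 + al) * gamma_density al k x - gamma_density al k.+1 x).
    by rewrite /plus /minus /plus /Hierarchy.opp /=; ring.
  apply: is_derive_plus; last exact: is_derive_gamma_densityS.
  apply: is_derive_minus; first exact: is_derive_lower_gamma.
  by apply: is_derive_scal; exact: is_derive_lower_gamma.
- have lgc j : continuous (lower_gamma al j) x.
    by apply: ex_derive_continuous; eexists; exact: is_derive_lower_gamma.
  apply/continuity_pt_filterlim.
  apply: (continuous_plus (fun x => lower_gamma al k.+1 x - (INR k + 1 + al) * lower_gamma al k x)).
    apply: (continuous_minus (lower_gamma al k.+1)) => //.
    by apply: (continuous_scal_r (INR k + 1 + al) (lower_gamma al k)).
  exact: continuous_gamma_density.
- have lg0 j : lower_gamma al j 0 = 0 by rewrite /lower_gamma RInt_point.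
  move: fM; rewrite /f !lg0 (gamma_densityS al k 0); lra.
Qed.

Lemma complete_gammaS al k : 0 < al ->
  complete_gamma al k.+1 = (INR k + 1 + al) * complete_gamma al k.
Proof.
move=> al_gt0; have h := is_lim_lower_gamma al k.+1 al_gt0.
have h2 : is_lim (lower_gamma al k.+1) p_infty ((INR k + 1 + al) * complete_gamma al k).
  apply: (is_lim_ext_loc (fun M => (INR k + 1 + al) * lower_gamma al k M - gamma_density al k.+1 M)).
    by exists 0 => M M_gt0; rewrite lower_gammaS //; lra.
  have -> : Rbar.Finite ((INR k + 1 + al) * complete_gamma al k) = Rbar.Finite ((INR k + 1 + al) * complete_gamma al k - 0).
    by rewrite Rminus_0_r.
  apply: is_lim_minus'; last exact: is_lim_gamma_density.
  by apply: (is_lim_scal_l _ (INR k + 1 + al) p_infty (complete_gamma al k)); exact: is_lim_lower_gamma.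
by have := is_lim_unique _ _ _ h; rewrite (is_lim_unique _ _ _ h2) => -[].
Qed.

(** * Moments in terms of Gamma integrals, their recurrence and their derivative in [t] *)

Lemma is_RInt_gen_of_lim (f F : R -> R) (m l : R) :
  (forall M, m < M -> is_RInt f 0 M (F M)) -> is_lim F p_infty l ->
  is_RInt_gen f (at_point 0) (Rbar_locally p_infty) l.
Proof.
move=> fF Fl Q /Fl [M HM].
apply: (Filter_prod _ _ _ (fun x => x = 0) (fun y => Rmax m M < y)) => //.
  by exists (Rmax m M).
move=> x y -> hy; exists (F y).
have [h1 h2] := (Rmax_l m M, Rmax_r m M).
by split; [apply: fF | apply: HM] => /=; lra.
Qed.

(** The integral is split at the jump: the factor is [A] before [t] and [A + B] after it. The two
    integrands are compared on open intervals, so the value at [t] itself does not matter. *)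
Lemma is_RInt_pow_weight al A B t k M : 0 < al -> 0 < t -> t < M ->
  is_RInt (fun x => x ^ k * weight al A B t x) 0 M
    ((A + B) * lower_gamma al k M - B * lower_gamma al k t).
Proof.
move=> al_gt0 t_gt0 ltM.
have lg0 : lower_gamma al k 0 = 0 by rewrite /lower_gamma RInt_point.
have -> : (A + B) * lower_gamma al k M - B * lower_gamma al k t =
  plus (scal A (lower_gamma al k t - lower_gamma al k 0))
       (scal (A + B) (lower_gamma al k M - lower_gamma al k t)).
  by rewrite lg0 /plus /scal /= /mult /=; ring.
apply: (is_RInt_Chasles _ 0 t M).
- apply: (is_RInt_ext (fun x => scal A (gamma_density al k x))); last first.
    by apply: is_RInt_scal; exact: is_RInt_gamma_density.
  move=> x; rewrite Rmin_left ?Rmax_right; try lra; move=> [h1 h2].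
  rewrite /scal /= /mult /= /gamma_density /weight /heaviside.
  by case: Rlt_dec => h /=; [lra | change (R0 : R) with 0; ring].
- apply: (is_RInt_ext (fun x => scal (A + B) (gamma_density al k x))); last first.
    by apply: is_RInt_scal; exact: is_RInt_gamma_density.
  move=> x; rewrite Rmin_left ?Rmax_right; try lra; move=> [h1 h2].
  rewrite /scal /= /mult /= /gamma_density /weight /heaviside.
  by case: Rlt_dec => h /=; [change (R1 : R) with 1; ring | lra].
Qed.

Lemma is_RInt_gen_pow_weight al A B t k : 0 < al -> 0 < t ->
  is_RInt_gen (fun x => x ^ k * weight al A B t x) (at_point 0) (Rbar_locally p_infty)
    ((A + B) * complete_gamma al k - B * lower_gamma al k t).
Proof.
move=> al_gt0 t_gt0.
apply (is_RInt_gen_of_lim _ (fun M => (A + B) * lower_gamma al k M - B * lower_gamma al k t) t).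
  by move=> M ltM; apply is_RInt_pow_weight.
apply is_lim_minus'; last by apply is_lim_const.
apply (is_lim_scal_l _ (A + B) p_infty (complete_gamma al k)).
by apply is_lim_lower_gamma.
Qed.

Lemma momentE al A B t k : 0 < al -> 0 < t ->
  moment al A B t k = (A + B) * complete_gamma al k - B * lower_gamma al k t.
Proof.
move=> al_gt0 t_gt0; rewrite /moment /int0inf.
by apply is_RInt_gen_unique, is_RInt_gen_pow_weight.
Qed.

Definition jump (al B t : R) : R := B * (Rpower t al * exp (- t)).

Lemma gamma_density_jump al B t k : 0 < t -> B * gamma_density al k t = jump al B t * t ^ k.
Proof. by move=> t_gt0; rewrite /gamma_density /jump xpow_pos //; ring. Qed.

(** The complete and incomplete Gamma recurrences have the same factor, so only the boundary term at
    the jump is left over. *)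
Lemma momentS al A B t k : 0 < al -> 0 < t ->
  moment al A B t k.+1 =
    (INR k + 1 + al) * moment al A B t k + jump al B t * t ^ k.+1.
Proof.
move=> al_gt0 t_gt0; rewrite !momentE // complete_gammaS // lower_gammaS //; last lra.
by rewrite -gamma_density_jump //; ring.
Qed.

Lemma near_pos (t : R) : 0 < t -> locally t (fun s => 0 < s).
Proof. by move=> t_gt0; apply: (open_gt 0 t). Qed.

Lemma is_derive_moment al A B t k : 0 < al -> 0 < t ->
  is_derive (fun s => moment al A B s k) t (- jump al B t * t ^ k).
Proof.
move=> al_gt0 t_gt0.
apply: (is_derive_ext_loc (fun s => (A + B) * complete_gamma al k - B * lower_gamma al k s)).
  by apply: filter_imp (near_pos t t_gt0) => s s_gt0; rewrite momentE.
have -> : - jump al B t * t ^ k = minus 0 (B * gamma_density al k t).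
  by rewrite gamma_density_jump // /minus /plus /Hierarchy.opp /=; ring.
apply: is_derive_minus; first exact: is_derive_const.
by apply: is_derive_scal; exact: is_derive_lower_gamma.
Qed.

(** * Elimination of the auxiliary quantities *)

(** Pure algebra: [H0], [H1], [H2] stand for H_n and its two derivatives, [Hp] and [Hm] for H_(n+1)
    and H_(n-1), and [Rn], [Rm], [r] for R_n, R_(n-1), r_n. *)
Lemma ladder_elimination (al t N H0 H1 H2 Hp Hm a b Rn Rm r : R) :
  t <> 0 -> r = t * H1 -> t * (t * H2) = b * (Rm - Rn) ->
  a = 2 * N + al + 1 + Rn -> b = r - H0 + N * (N + al) ->
  r ^ 2 = b * Rn * Rm -> b * (Rn + Rm) = (t - 2 * N - al) * r - t * H0 ->
  Hp = H0 - Rn -> Hm = H0 + Rm ->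
  (2 * (H0 - N * (N + al) - t * H1) <> 0 ->
     a - (2 * N + al + 1) =
     (t ^ 2 * H2 + ((2 * N + al) * t - t ^ 2) * H1 + t * H0)
       / (2 * (H0 - N * (N + al) - t * H1))) /\
  b - N * (N + al) = t * H1 - H0 /\
  (t * H2) ^ 2 = 4 * H1 ^ 2 * (H0 - N * (N + al) - t * H1)
                 + ((2 * N + al - t) * H1 + H0) ^ 2 /\
  a - (2 * N + al + 1) = H0 - Hp /\
  (t + Hp - Hm - 2 * N - al <> 0 ->
     b - N * (N + al) =
     (H0 * (2 * N + al) - N * (N + al) * (Hp - Hm)) / (t + Hp - Hm - 2 * N - al)) /\
  (t + Hp - Hm - 2 * N - al <> 0 ->
     (((H0 - N * (N + al)) * (t + Hp - Hm) + t * N * (N + al))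
        / (t + Hp - Hm - 2 * N - al)) ^ 2 =
     (((2 * N + al) * (H0 - N * (N + al)) + t * N * (N + al))
        / (t + Hp - Hm - 2 * N - al)) * (H0 - Hp) * (Hm - H0)).
Proof.
move=> t0 rE H2E aE bE rr bR -> ->.
have bd : H0 - N * (N + al) - t * H1 = - b by rewrite bE rE; ring.
rewrite bd aE.
have e0 : 2 * N + al + 1 + Rn - (2 * N + al + 1) = Rn by ring.
have dE : t + (H0 - Rn) - (H0 + Rm) - 2 * N - al = t - Rn - Rm - 2 * N - al by ring.
rewrite e0 dE.
(* The relation for b (Rn + Rm) makes [b] times the second denominator explicit; the last two
   identities both rest on this. *)
have bden : b * (t - Rn - Rm - 2 * N - al) =
    (2 * N + al) * (H0 - N * (N + al)) + t * N * (N + al).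
  have -> : b * (t - Rn - Rm - 2 * N - al) = b * (t - 2 * N - al) - b * (Rn + Rm) by ring.
  by rewrite bR bE; ring.
split; [|split; [|split; [|split; [|split]]]].
(* Here 2 b Rn is the sum b (Rn + Rm) minus the difference b (Rm - Rn), and the latter is t^2 H2. *)
- move=> b0; have b0' : b <> 0 by move=> e; apply: b0; rewrite e; ring.
  apply: (Rmult_eq_reg_r (2 * - b)) => //.
  have -> : (t ^ 2 * H2 + ((2 * N + al) * t - t ^ 2) * H1 + t * H0) / (2 * - b) * (2 * - b)
    = t * (t * H2) - ((t - 2 * N - al) * (t * H1) - t * H0) by field.
  by rewrite H2E -rE -bR; ring.
- by rewrite bE rE; ring.
(* After scaling by t^2 this is (Rm - Rn)^2 = (Rm + Rn)^2 - 4 Rn Rm times b^2, with b Rn Rm =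
   r^2. *)
- apply: (Rmult_eq_reg_l (t ^ 2)); last exact: pow_nonzero.
  have -> : t ^ 2 * (t * H2) ^ 2 = (t * (t * H2)) ^ 2 by ring.
  have -> : t ^ 2 * (4 * H1 ^ 2 * - b + ((2 * N + al - t) * H1 + H0) ^ 2) =
    - 4 * b * (t * H1) ^ 2 + ((t - 2 * N - al) * (t * H1) - t * H0) ^ 2 by ring.
  by rewrite H2E -rE rr -bR; ring.
- by ring.
- move=> d0; apply: (Rmult_eq_reg_r (t - Rn - Rm - 2 * N - al)) => //.
  by rewrite Rmult_minus_distr_r bden; field.
(* The quotient on the left equals [r] and the one on the right equals [b], so the claim becomes r^2
   = b Rn Rm. *)
- move=> d0; rewrite -bden.
  have -> : b * (t - Rn - Rm - 2 * N - al) / (t - Rn - Rm - 2 * N - al) = b by field.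
  have -> : ((H0 - N * (N + al)) * (t + (H0 - Rn) - (H0 + Rm)) + t * N * (N + al))
    / (t - Rn - Rm - 2 * N - al) = r.
    apply: (Rmult_eq_reg_r (t - Rn - Rm - 2 * N - al)) => //.
    have -> : r = b + H0 - N * (N + al) by rewrite bE; ring.
    have -> : (b + H0 - N * (N + al)) * (t - Rn - Rm - 2 * N - al) =
      b * (t - Rn - Rm - 2 * N - al) + (H0 - N * (N + al)) * (t - Rn - Rm - 2 * N - al) by ring.
    by rewrite bden; field.
  by rewrite rr; ring.
Qed.

From mathcomp Require Import ring.
Import Order.TTheory GRing.Theory Num.Theory.

(** * Orthogonal polynomials of a positive moment functional *)

Section MomentFunctional.
Local Set Implicit Arguments.
Local Unset Strict Implicit.
Local Unset Printing Implicit Defensive.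
Local Open Scope ring_scope.
Variables (F : fieldType) (mu : nat -> F).

Definition lfun (p : {poly F}) : F := \sum_(i < size p) p`_i * mu i.

Lemma lfunE (p : {poly F}) N : (size p <= N)%N -> lfun p = \sum_(i < N) p`_i * mu i.
Proof.
move=> le_pN; rewrite /lfun (big_ord_widen _ (fun i => p`_i * mu i) le_pN) big_mkcond.
by apply: eq_bigr => i _; case: ltnP => // ?; rewrite nth_default ?mul0r.
Qed.

Lemma lfun_is_scalar (a : F) (p q : {poly F}) : lfun (a *: p + q) = a * lfun p + lfun q.
Proof.
pose N := maxn (size p) (size q).
have lep : (size p <= N)%N by exact: leq_maxl.
have leqN : (size q <= N)%N by exact: leq_maxr.
have leD : (size (a *: p + q)%R <= N)%N.
  by rewrite (leq_trans (size_polyD _ _)) // geq_max leqN (leq_trans (size_scale_leq _ _)).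
rewrite (lfunE leD) (lfunE lep) (lfunE leqN) mulr_sumr -big_split /=.
by apply: eq_bigr => i _; rewrite coefD coefZ; ring.
Qed.

HB.instance Definition _ := GRing.isLinear.Build F {poly F} F *%R lfun lfun_is_scalar.

Lemma lfunD p q : lfun (p + q) = lfun p + lfun q. Proof. exact: linearD. Qed.
Lemma lfunB p q : lfun (p - q) = lfun p - lfun q. Proof. exact: linearB. Qed.
Lemma lfunZ a p : lfun (a *: p) = a * lfun p. Proof. exact: linearZ. Qed.

Lemma lfunXn i : lfun 'X^i = mu i.
Proof.
rewrite /lfun size_polyXn big_ord_recr big1 /= => [|j _].
  by rewrite coefXn eqxx mul1r add0r.
by rewrite coefXn ltn_eqF ?mul0r.
Qed.

(** The functional on products is the bilinear form of the Hankel matrix; this links orthogonality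
    to the determinant. *)
Lemma lfunM (p q : {poly F}) N : (size p <= N)%N -> (size q <= N)%N ->
  lfun (p * q) = \sum_(i < N) \sum_(j < N) p`_i * mu (i + j)%N * q`_j.
Proof.
have expand (r : {poly F}) : (size r <= N)%N -> r = \sum_(i < N) r`_i *: 'X^i.
  move=> le_rN; rewrite -{1}[r]coefK poly_def (big_ord_widen _ (fun i => r`_i *: 'X^i) le_rN).
  by rewrite big_mkcond; apply: eq_bigr => i _; case: ltnP => // ?; rewrite nth_default ?scale0r.
move=> lep leqN; rewrite {1}(expand p lep) {1}(expand q leqN) mulr_suml linear_sum.
apply: eq_bigr => i _; rewrite mulr_sumr linear_sum; apply: eq_bigr => j _.
by rewrite -scalerAl -scalerAr -exprD !linearZ /= lfunXn; ring.
Qed.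

(* Integration by parts of [x p(x) x^al e^(-x)] against the jump weight. *)
Lemma lfun_pearson (al c t : F) (p : {poly F}) :
  (forall k, mu k.+1 = (k%:R + 1 + al) * mu k + c * t ^+ k.+1) ->
  lfun ('X * p^`()) + (al + 1) * lfun p - lfun ('X * p) = - (c * t) * p.[t].
Proof.
move=> muS; pose s (f : nat -> {poly F}) := \sum_(i < size p) p`_i *: f i.
have pE : p = s (fun i => 'X^i) by rewrite /s -{1}[p]coefK poly_def.
have XpE : 'X * p = s (fun i => 'X^(i.+1)).
  rewrite {1}pE /s mulr_sumr; apply: eq_bigr => i _.
  by rewrite -scalerAr -exprS.
have XdE : 'X * p^`() = s (fun i => 'X^i *+ i).
  rewrite {1}pE /s raddf_sum mulr_sumr; apply: eq_bigr => i _.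
  rewrite /= derivZ derivXn -scalerAr; congr (_ *: _).
  by case: (i : nat) => [|j] /=; rewrite ?mulr0n ?mulr0 // mulrnAr -exprS.
rewrite XpE XdE {1}pE horner_coef /s !linear_sum !mulr_sumr -big_split -sumrB /=.
apply: eq_bigr => i _.
by rewrite !linearZ /= !lfunXn linearMn /= lfunXn muS exprS; ring.
Qed.

End MomentFunctional.

(** * Uniqueness and construction of monic orthogonal polynomials, and the Hankel determinant *)

Section MonicOrthogonal.
Local Set Implicit Arguments.
Local Unset Strict Implicit.
Local Unset Printing Implicit Defensive.
Local Open Scope ring_scope.
Variables (F : realFieldType) (mu : nat -> F).
Local Notation L := (lfun mu).
Hypothesis mu_pos : forall p : {poly F}, p != 0 -> 0 < L (p ^+ 2).

Definition graded_monic (P : nat -> {poly F}) :=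
  forall n, P n \is monic /\ size (P n) = n.+1.

Definition orthogonal (P : nat -> {poly F}) :=
  forall m n, m <> n -> L (P m * P n) = 0.

Lemma graded_monic_lead P n : graded_monic P -> (P n)`_n = 1.
Proof. by case/(_ n) => /monicP; rewrite lead_coefE => + sz; rewrite sz. Qed.

Lemma size_sub_lead (P : nat -> {poly F}) (q : {poly F}) n : graded_monic P ->
  (size q <= n.+1)%N -> (size (q - q`_n *: P n)%R <= n)%N.
Proof.
move=> gP szq; apply/leq_sizeP => j le_nj; rewrite coefB coefZ.
case: (ltngtP j n) le_nj => // [lt_nj _ | -> _].
  have Pj : (P n)`_j = 0 by rewrite nth_default // (gP n).2.
  by rewrite Pj mulr0 subr0 nth_default // (leq_trans szq).
by rewrite (graded_monic_lead _ gP) mulr1 subrr.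
Qed.

(** Multiples of P_k are stripped from [q] by descending degree. Orthogonality is assumed against
    smaller indices only, so results of this form apply inside the induction that proves [ops]
    orthogonal. *)
Lemma orthogonal_lower P n (q : {poly F}) : graded_monic P ->
  (forall m, (m < n)%N -> L (P n * P m) = 0) -> (size q <= n)%N -> L (P n * q) = 0.
Proof.
move=> gP oP; suff H k (r : {poly F}) : (k <= n)%N -> (size r <= k)%N -> L (P n * r) = 0 by exact: H.
elim: k r => [|k IHk] r le_kn szr.
  by move: szr; rewrite leqn0 size_poly_eq0 => /eqP ->; rewrite mulr0 linear0.
rewrite -(subrK (r`_k *: P k) r) mulrDr lfunD -scalerAr lfunZ oP // mulr0 addr0.
by apply: IHk; [exact: ltnW | exact: (size_sub_lead gP)].
Qed.

Lemma orthogonal_top P n (q : {poly F}) : graded_monic P ->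
  (forall m, (m < n)%N -> L (P n * P m) = 0) -> (size q <= n.+1)%N ->
  L (P n * q) = q`_n * L (P n ^+ 2).
Proof.
move=> gP oP szq; rewrite -{1}(subrK (q`_n *: P n) q) mulrDr lfunD.
by rewrite (orthogonal_lower gP oP) ?(size_sub_lead gP) // add0r -scalerAr lfunZ expr2.
Qed.

Lemma norm_gt0 P n : graded_monic P -> 0 < L (P n ^+ 2).
Proof. by move=> gP; apply: mu_pos; rewrite monic_neq0 // (gP n).1. Qed.

(** The difference of the two polynomials has degree below n, hence is orthogonal to both of them
    and so to itself; positivity makes it zero. *)
Lemma orthogonal_unique P Q n : graded_monic P -> orthogonal P ->
  graded_monic Q -> orthogonal Q -> P n = Q n.
Proof.
move=> gP oP gQ oQ; apply/eqP; rewrite -subr_eq0; apply/negP => /negP /mu_pos.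
have szd : (size (P n - Q n)%R <= n)%N.
  have := size_sub_lead gQ (q := P n) (n := n).
  by rewrite (graded_monic_lead _ gP) scale1r (gP n).2; apply.
rewrite expr2 mulrBl lfunB !orthogonal_lower ?subrr ?ltxx // => m lt_mn.
  by apply/oQ/eqP; rewrite gtn_eqF.
by apply/oP/eqP; rewrite gtn_eqF.
Qed.

(** Pairing with P_n and with P_(n-1) isolates each coefficient. *)
Lemma recurrence_unique P n (a a' b b' : F) : graded_monic P -> orthogonal P -> (0 < n)%N ->
  a *: P n + b *: P n.-1 = a' *: P n + b' *: P n.-1 -> a = a' /\ b = b'.
Proof.
case: n => // n gP oP _ /= e.
have on : L (P n.+1 * P n) = 0 by apply/oP/eqP; rewrite gtn_eqF.
have on' : L (P n * P n.+1) = 0 by rewrite mulrC.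
have step k : L (P k * (a *: P n.+1 + b *: P n)) = L (P k * (a' *: P n.+1 + b' *: P n)).
  by rewrite e.
have [hn hn1] := (norm_gt0 n gP, norm_gt0 n.+1 gP).
move: (step n.+1) (step n); rewrite !mulrDr !lfunD -!scalerAr !lfunZ -!expr2.
rewrite on on' !mulr0 !addr0 !add0r => e1 e2.
by split; [apply: (mulIf (lt0r_neq0 hn1)) | apply: (mulIf (lt0r_neq0 hn))].
Qed.

(* [ops_pair n = (P_n, P_(n-1))], with [P_(-1) = 0]. *)
Fixpoint ops_pair (n : nat) : {poly F} * {poly F} :=
  if n is m.+1 then
    let: (p, q) := ops_pair m in
    (('X - (L ('X * p ^+ 2) / L (p ^+ 2))%:P) * p - (L (p ^+ 2) / L (q ^+ 2)) *: q, p)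
  else (1, 0).

Definition ops n : {poly F} := (ops_pair n).1.
Definition ops_norm n : F := L (ops n ^+ 2).
Definition ops_a n : F := L ('X * ops n ^+ 2) / ops_norm n.
(** Since [0.-1] is [0], the term [ops n.-1] is 1 at index 0 and not P_(-1) = 0; the value 0 chosen
    here removes it from the recurrence. *)
Definition ops_b n : F := if n is m.+1 then ops_norm n / ops_norm m else 0.

Lemma ops0 : ops 0 = 1. Proof. by []. Qed.

Lemma opsS n : ops n.+1 = ('X - (ops_a n)%:P) * ops n - ops_b n *: ops n.-1.
Proof.
have pE m : ops_pair m = (ops m, if m is k.+1 then ops k else 0).
  by case: m => //= m; rewrite /ops /=; case: (ops_pair m).
rewrite {1}/ops /= pE /= /ops_a /ops_b /ops_norm.
(* At index 0 the pair carries the zero polynomial and [ops_b] is 0, so both last terms vanish. *)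
by case: n => [|n] //; rewrite !scaler0 scale0r.
Qed.

Lemma ops_recurrence n : 'X * ops n = ops n.+1 + ops_a n *: ops n + ops_b n *: ops n.-1.
Proof. by rewrite opsS mulrBl mul_polyC; ring. Qed.

Lemma ops_graded_monic : graded_monic ops.
Proof.
suff H n : [/\ ops n \is monic, size (ops n) = n.+1 & (size (ops n.-1) <= n.+1)%N].
  by move=> n; case: (H n).
elim: n => [|n [mn szn szn1]]; first by rewrite ops0 monic1 size_poly1.
have szl : size (('X - (ops_a n)%:P) * ops n) = n.+2.
  by rewrite size_monicM ?monicXsubC ?monic_neq0 // size_XsubC szn.
have szr : (size (- (ops_b n *: ops n.-1))%R < size (('X - (ops_a n)%:P) * ops n)%R)%N.
  by rewrite szl size_polyN ltnS (leq_trans (size_scale_leq _ _)).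
split; last by rewrite /= szn.
  rewrite opsS monicE lead_coefDl // lead_coefM (monicP mn) lead_coefXsubC mulr1.
  by rewrite eqxx.
by rewrite opsS size_polyDl.
Qed.

Lemma ops_norm_gt0 n : 0 < ops_norm n.
Proof. exact/norm_gt0/ops_graded_monic. Qed.

Lemma ops_norm_neq0 n : ops_norm n != 0.
Proof. exact/lt0r_neq0/ops_norm_gt0. Qed.

(** Strong induction on n: against P_n the new polynomial vanishes by the choice of [ops_a], against
    P_(n-1) by that of [ops_b], and against lower ones because X P_m has degree below n. *)
Lemma ops_orth_lt n : forall m, (m < n)%N -> L (ops n * ops m) = 0.
Proof.
elim/ltn_ind: n => -[|n] // IH m; rewrite ltnS => le_mn.
have orth i j : (i <= n)%N -> (j <= n)%N -> i != j -> L (ops i * ops j) = 0.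
  move=> lei lej; case: ltngtP => // lt _; last exact: IH.
  by rewrite mulrC; exact: IH.
rewrite opsS mulrBl -mulrA mulrBl mul_polyC !lfunB -scalerAl !lfunZ.
case: (ltngtP m n) le_mn => // [lt_mn | ->] _; last first.
  rewrite -expr2 /ops_a -/(ops_norm n) divfK ?ops_norm_neq0 // subrr sub0r.
  case: n {IH} orth => [|n] orth /=; first by rewrite mul0r oppr0.
  by rewrite orth ?mulr0 ?oppr0 // neq_ltn ltnSn.
rewrite (orth n m) ?(ltnW lt_mn) // ?gtn_eqF // mulr0 subr0.
have -> : 'X * (ops n * ops m) = ops n * ('X * ops m) by ring.
case: n IH lt_mn orth => // n IH lt_mn orth /=.
have [gO oO] := (ops_graded_monic, IH n.+1 (ltnSn _)).
have szX : size ('X * ops m) = m.+2 by rewrite size_monicM ?monicX ?size_polyX ?(gO m).2 // monic_neq0 // (gO m).1.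
rewrite (orthogonal_top gO oO); last by rewrite szX.
rewrite coefXM /=; move: lt_mn; rewrite ltnS leq_eqVlt => /orP [/eqP -> | lt_mn].
  rewrite (graded_monic_lead _ gO) mul1r -expr2 -/(ops_norm n) -/(ops_norm n.+1).
  by rewrite divfK ?subrr // ops_norm_neq0.
rewrite (orth n m) ?(ltnW (leqW lt_mn)) ?leqW // ?gtn_eqF // nth_default ?(gO m).2 //.
by rewrite mulr0 mul0r subr0.
Qed.

Lemma ops_orthogonal : orthogonal ops.
Proof.
move=> m n; case: (ltngtP m n) => // lt _; last exact: ops_orth_lt.
by rewrite mulrC; exact: ops_orth_lt.
Qed.

(** The coefficient matrix [T] of the polynomials is unitriangular and turns the Hankel matrix into
    the diagonal matrix of the norms. *)
Lemma det_hankel n : \det (\matrix_(i < n, j < n) mu (i + j)%N) = \prod_(j < n) ops_norm j.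
Proof.
have gO := ops_graded_monic.
set M := \matrix_(i < n, j < n) mu _.
pose T := \matrix_(i < n, j < n) (ops i)`_j.
have TMT : T *m M *m T^T = diag_mx (\row_(j < n) ops_norm j).
  apply/matrixP => i j; rewrite !mxE.
  transitivity (L (ops i * ops j)).
    rewrite (@lfunM _ _ _ _ n) ?(gO _).2 ?ltn_ord // exchange_big /=.
    apply: eq_bigr => l _; rewrite !mxE mulr_suml; apply: eq_bigr => k _.
    by rewrite !mxE.
  have [<- | ne_ij] := eqVneq i j; first by rewrite mulr1n -expr2.
  by rewrite mulr0n ops_orthogonal // => /val_inj e; rewrite e eqxx in ne_ij.
have dT : \det T = 1.
  rewrite det_trig; last first.
    by apply/is_trig_mxP => i j lt_ij; rewrite mxE nth_default // (gO i).2.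
  by rewrite big1 // => i _; rewrite mxE graded_monic_lead.
have := congr1 determinant TMT; rewrite !det_mulmx det_tr dT mul1r mulr1 det_diag => ->.
by apply: eq_bigr => j _; rewrite mxE.
Qed.

End MonicOrthogonal.

(** * Consequences of the Pearson relation *)

Section Pearson.
Local Set Implicit Arguments.
Local Unset Strict Implicit.
Local Unset Printing Implicit Defensive.
Local Open Scope ring_scope.
Variables (F : realFieldType) (mu : nat -> F) (al c t : F).
Local Notation L := (lfun mu).
Hypothesis mu_pos : forall p : {poly F}, p != 0 -> 0 < L (p ^+ 2).
Hypothesis muS : forall k, mu k.+1 = (k%:R + 1 + al) * mu k + c * t ^+ k.+1.
Local Notation P := (ops mu).
Local Notation h := (ops_norm mu).

Definition ops_R n : F := t * c * (P n).[t] ^+ 2 / h n.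
(** For n >= 1, b_n / h_n is 1 / h_(n-1); this form also gives r_0 = 0. *)
Definition ops_r n : F := t * c * ops_b mu n * (P n).[t] * (P n.-1).[t] / h n.
Definition ops_H n : F := - \sum_(j < n) ops_R j.
Definition ops_subleading n : F := if n is m.+1 then (P n)`_m else 0.

Let h_neq0 n : h n != 0 := ops_norm_neq0 mu_pos n.
Let gP : graded_monic P := ops_graded_monic mu.
Let oP n : forall m, (m < n)%N -> L (P n * P m) = 0 := ops_orth_lt mu_pos (n := n).

Lemma coef_Xderiv (p : {poly F}) i : ('X * p^`())`_i = p`_i *+ i.
Proof. by rewrite coefXM; case: i => [|i] /=; rewrite ?mulr0n // coef_deriv. Qed.

Lemma size_Xderiv (p : {poly F}) N : (size p <= N)%N -> (size ('X * p^`())%R <= N)%N.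
Proof.
move=> szp; apply/leq_sizeP => j le_Nj.
by rewrite coef_Xderiv nth_default ?mul0rn // (leq_trans szp).
Qed.

(** The Pearson relation for P_n^2: the leading coefficient of X P_n' is n, so the derivative term
    contributes 2 n h_n. *)
Lemma ops_aE n : ops_a mu n = 2 * n%:R + al + 1 + ops_R n.
Proof.
have := lfun_pearson (P n ^+ 2) muS.
have -> : 'X * (P n ^+ 2)^`() = 2 *: (P n * ('X * (P n)^`())).
  by rewrite expr2 derivM scaler_nat; ring.
rewrite lfunZ (orthogonal_top gP (oP (n := n))) ?size_Xderiv ?(gP n).2 //.
rewrite coef_Xderiv (graded_monic_lead _ gP) horner_exp -/(h n).
have hn := h_neq0 n; rewrite /ops_a /ops_R => e.
apply: (mulIf hn); rewrite divfK // mulrDl divfK //.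
have -> : L ('X * P n ^+ 2) = 2 * (1 *+ n * h n) + (al + 1) * h n + c * t * (P n).[t] ^+ 2.
  by rewrite -[RHS](subrK (L ('X * P n ^+ 2))) -addrA [_ + L _]addrC; move: e => /eqP; rewrite subr_eq => /eqP ->; ring.
by ring.
Qed.

Lemma ops_subleadingS n : ops_subleading n.+1 = ops_subleading n - ops_a mu n.
Proof.
rewrite {1}/ops_subleading opsS coefB coefZ mulrBl coefB coefXM mul_polyC coefZ.
rewrite (graded_monic_lead _ gP) mulr1; case: n => [|n] /=; first by ring.
by rewrite [(P n)`_n.+1]nth_default ?(gP n).2 // mulr0 subr0.
Qed.

(** Telescoping: the sum of 2j + 1 + al over j < n is n (n + al), and the R_j add up to -H_n. *)
Lemma ops_subleadingE n : ops_subleading n = ops_H n - n%:R * (n%:R + al).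
Proof.
elim: n => [|n IH]; first by rewrite /ops_H big_ord0 oppr0 mul0r subr0.
by rewrite ops_subleadingS IH ops_aE /ops_H big_ord_recr /= -natr1; ring.
Qed.

Lemma ops_rE n : ops_r n = ops_subleading n + ops_b mu n.
Proof.
case: n => [|n]; first by rewrite /ops_r /= mulr0 !mul0r addr0.
have hn := h_neq0 n; have hn1 := h_neq0 n.+1.
have := lfun_pearson (P n.+1 * P n) muS.
(* Subtracting (n+1) P_(n+1) from X P_(n+1)' leaves degree at most n, with coefficient -p_(n+1)
   there; this is how the subleading coefficient enters. *)
have -> : 'X * (P n.+1 * P n)^`() =
    P n * ('X * (P n.+1)^`() - n.+1%:R *: P n.+1) + n.+1%:R *: (P n.+1 * P n)
    + P n.+1 * ('X * (P n)^`()).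
  by rewrite derivM -!mul_polyC; ring.
have szq : (size ('X * (P n.+1)^`() - n.+1%:R *: P n.+1)%R <= n.+1)%N.
  apply/leq_sizeP => j le_nj; rewrite coefB coefZ coef_Xderiv.
  move: le_nj; rewrite leq_eqVlt => /orP [/eqP <- | lt_nj].
    by rewrite (graded_monic_lead _ gP) mulr1 subrr.
  by rewrite nth_default ?(gP _).2 // mul0rn mulr0 subr0.
rewrite !lfunD lfunZ (oP (ltnSn n)) (orthogonal_top gP (oP (n := n))) //.
rewrite coefB coefZ coef_Xderiv -/(h n).
rewrite (orthogonal_lower gP (oP (n := n.+1))) ?size_Xderiv ?(gP n).2 //.
have -> : 'X * (P n.+1 * P n) = P n.+1 * ('X * P n) by ring.
rewrite (orthogonal_top gP (oP (n := n.+1))); last first.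
  by rewrite size_monicM ?monicX ?size_polyX ?(gP n).2 // monic_neq0 // (gP n).1.
rewrite coefXM /= (graded_monic_lead _ gP) -/(h n.+1) hornerM => e.
rewrite /ops_r /ops_b /=; apply: (mulIf hn).
have -> : t * c * (h n.+1 / h n) * (P n.+1).[t] * (P n).[t] / h n.+1 * h n =
  c * t * ((P n.+1).[t] * (P n).[t]) by field; rewrite hn hn1.
have -> : c * t * ((P n.+1).[t] * (P n).[t]) = - (- (c * t) * ((P n.+1).[t] * (P n).[t])) by ring.
by rewrite -e -[in LHS]mulr_natr -!natr1; field.
Qed.

Lemma ops_r_sqr n : (0 < n)%N -> ops_r n ^+ 2 = ops_b mu n * ops_R n * ops_R n.-1.
Proof.
case: n => // n _; rewrite /ops_r /ops_R /ops_b /=.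
by field; rewrite !h_neq0.
Qed.

Let ev n : t * (P n).[t] = (P n.+1).[t] + ops_a mu n * (P n).[t] + ops_b mu n * (P n.-1).[t].
Proof. by have /(congr1 (horner^~ t)) := ops_recurrence mu n; rewrite !hornerE. Qed.

Lemma ops_b_norm n : ops_b mu n.+1 = h n.+1 / h n. Proof. by []. Qed.

(** The recurrence at x = t, multiplied by t c P_n(t) / h_n. *)
Lemma ops_r_sum n : ops_r n + ops_r n.+1 = (t - ops_a mu n) * ops_R n.
Proof.
have hn := h_neq0 n; have hn1 := h_neq0 n.+1.
have e := ev n.
have -> : ops_r n.+1 = t * c * (P n.+1).[t] * (P n).[t] / h n.
  by rewrite /ops_r ops_b_norm /=; field; rewrite hn hn1.
have -> : (P n.+1).[t] = t * (P n).[t] - ops_a mu n * (P n).[t] - ops_b mu n * (P n.-1).[t].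
  by rewrite e; ring.
by rewrite /ops_r /ops_R; field.
Qed.

(** Both terms on the left are t c / h_n times a square, of P_(n+1)(t) and of b_n P_(n-1)(t). Their
    difference factors, and the sum of the two roots is (t - a_n) P_n(t) by the recurrence. *)
Lemma ops_bR_diff n : ops_b mu n.+1 * ops_R n.+1 - ops_b mu n * ops_R n.-1 =
  (ops_r n.+1 - ops_r n) * (t - ops_a mu n).
Proof.
have hn := h_neq0 n; have hn1 := h_neq0 n.+1.
have -> : ops_r n.+1 = t * c * (P n.+1).[t] * (P n).[t] / h n.
  by rewrite /ops_r ops_b_norm /=; field; rewrite hn hn1.
have -> : ops_b mu n.+1 * ops_R n.+1 = t * c * (P n.+1).[t] ^+ 2 / h n.
  by rewrite /ops_R ops_b_norm /=; field; rewrite hn hn1.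
have -> : ops_b mu n * ops_R n.-1 = t * c * (ops_b mu n * (P n.-1).[t]) ^+ 2 / h n.
  case: (n) => [|m]; first by rewrite /ops_b; ring.
  by rewrite /ops_R ops_b_norm /=; field; rewrite !h_neq0.
have -> : ops_r n = t * c * (P n).[t] * (ops_b mu n * (P n.-1).[t]) / h n.
  by rewrite /ops_r; ring.
have -> : ops_b mu n * (P n.-1).[t] = (t - ops_a mu n) * (P n).[t] - (P n.+1).[t].
  by have e := ev n; rewrite mulrBl e; ring.
by field.
Qed.

(* By induction: the difference of two consecutive instances reduces to
   [ops_bR_diff], which avoids dividing by [R_n] (zero when [P_n(t) = 0]). *)
Lemma ops_bR_sum n : ops_b mu n * (ops_R n + ops_R n.-1) =
  (t - 2 * n%:R - al) * ops_r n - t * ops_H n.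
Proof.
elim: n => [|n IH].
  by rewrite /ops_H big_ord0 /ops_r /=; ring.
have aE := ops_aE n; have rs := ops_r_sum n; have bR := ops_bR_diff n.
have bE k : ops_b mu k = ops_r k - ops_H k + k%:R * (k%:R + al).
  by rewrite ops_rE ops_subleadingE; ring.
have HS : ops_H n.+1 = ops_H n - ops_R n by rewrite /ops_H big_ord_recr /=; ring.
have bE1 := bE n.+1; have bE0 := bE n.
rewrite HS -natr1 in bE1; rewrite HS -natr1 /=.
(* This increment of b_n replaces the shifted coefficient, so that everything reduces to index n. *)
have db : ops_b mu n.+1 = ops_b mu n + ops_r n.+1 - ops_r n + ops_a mu n.
  by rewrite bE1 bE0 aE; ring.
have -> : ops_b mu n.+1 * (ops_R n.+1 + ops_R n) = ops_b mu n.+1 * ops_R n.+1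
    + (ops_b mu n + ops_r n.+1 - ops_r n + ops_a mu n) * ops_R n.
  by rewrite -db; ring.
have -> : ops_b mu n.+1 * ops_R n.+1 = ops_b mu n * ops_R n.-1 + (ops_r n.+1 - ops_r n) * (t - ops_a mu n).
  by rewrite -bR; ring.
have -> : ops_b mu n * ops_R n.-1 = (t - 2 * n%:R - al) * ops_r n - t * ops_H n - ops_b mu n * ops_R n.
  by rewrite -IH; ring.
have -> : ops_r n.+1 = (t - ops_a mu n) * ops_R n - ops_r n by rewrite -rs; ring.
by rewrite aE; ring.
Qed.

End Pearson.

(** * Evolution in the position of the jump *)

Section Calculus.
Local Set Implicit Arguments.
Local Unset Strict Implicit.
Local Unset Printing Implicit Defensive.
Local Open Scope ring_scope.
Implicit Types (f g : R -> R) (p q : R -> {poly R}) (t : R).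

Lemma is_deriveD f g t (df dg : R) : is_derive f t df -> is_derive g t dg ->
  is_derive (fun s => f s + g s) t (df + dg).
Proof. exact: is_derive_plus. Qed.

Lemma is_deriveM f g t (df dg : R) : is_derive f t df -> is_derive g t dg ->
  is_derive (fun s => f s * g s) t (df * g t + f t * dg).
Proof. by move=> hf hg; apply: is_derive_mult => // n m; exact: Rmult_comm. Qed.

Lemma is_derive_sum n (f : nat -> R -> R) t (df : nat -> R) :
  (forall i, (i < n)%N -> is_derive (f i) t (df i)) ->
  is_derive (fun s => \sum_(i < n) f i s) t (\sum_(i < n) df i).
Proof.
elim: n => [|n IH] hf.
  rewrite big_ord0; apply: (is_derive_ext (fun _ : R => 0 : R)) => [s|]; first by rewrite big_ord0.
  exact: is_derive_const.
rewrite big_ord_recr; apply: (is_derive_ext (fun s => \sum_(i < n) f i s + f n s)) => [s|].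
  by rewrite big_ord_recr.
by apply: is_deriveD; [apply: IH => i /leqW; exact: hf | exact: hf].
Qed.

Lemma is_derive_div f g t (df dg : R) : g t != 0 ->
  is_derive f t df -> is_derive g t dg ->
  is_derive (fun s => f s / g s) t ((df * g t - f t * dg) / g t ^+ 2).
Proof.
move=> gt0 hf hg.
have -> : (df * g t - f t * dg) / g t ^+ 2 = df * Rinv (g t) + f t * Rdiv (- dg) (pow (g t) 2).
  by rewrite RpowE RinvE RdivE RoppE; field.
by apply: is_deriveM => //; apply: is_derive_inv => //; apply/eqP.
Qed.

(** Differentiation is coefficientwise, so no topology on polynomials is involved. *)
Definition is_poly_derive p t (dp : {poly R}) :=
  forall i, is_derive (fun s => (p s)`_i) t dp`_i.

Lemma is_poly_deriveM p q t dp dq : is_poly_derive p t dp -> is_poly_derive q t dq ->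
  is_poly_derive (fun s => p s * q s) t (dp * q t + p t * dq).
Proof.
move=> hp hq i; rewrite coefD !coefM -big_split /=.
apply: (is_derive_ext (fun s => \sum_(j < i.+1) (p s)`_j * (q s)`_(i - j))) => [s|].
  by rewrite coefM.
apply: (is_derive_sum (f := fun j s => (p s)`_j * (q s)`_(i - j))
  (df := fun j => dp`_j * (q t)`_(i - j) + (p t)`_j * dq`_(i - j))).
by move=> j _; exact: is_deriveM.
Qed.

Lemma size_poly_derive p t dp N : (forall s, (size (p s) <= N)%N) ->
  is_poly_derive p t dp -> (size dp <= N)%N.
Proof.
move=> szp hp; apply/leq_sizeP => j le_Nj.
rewrite -(is_derive_unique _ _ _ (hp j)); apply: is_derive_unique.
apply: (is_derive_ext (fun _ : R => 0 : R)); last exact: is_derive_const.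
by move=> s; rewrite nth_default // (leq_trans (szp s)).
Qed.

Lemma ex_poly_derive p t N : (forall s, (size (p s) <= N)%N) ->
  (forall i, ex_derive (fun s => (p s)`_i) t) -> exists dp, is_poly_derive p t dp.
Proof.
move=> szp hp; exists (\poly_(i < N) Derive (fun s => (p s)`_i) t) => i.
rewrite coef_poly; case: ltnP => [_ | le_Ni].
  by apply: Derive_correct; exact: hp.
apply: (is_derive_ext (fun _ : R => 0 : R)); last exact: is_derive_const.
by move=> s; rewrite nth_default // (leq_trans (szp s)).
Qed.

End Calculus.

(** * Derivatives in [t] of the orthogonal polynomials, their norms and the Hankel determinant *)

Section Deformation.
Local Set Implicit Arguments.
Local Unset Strict Implicit.
Local Unset Printing Implicit Defensive.
Local Open Scope ring_scope.
Variables (mu : R -> nat -> R) (c : R -> R) (al : R).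
Hypothesis mu_pos : forall t : R, 0 < t -> forall p : {poly R}, p != 0 -> 0 < lfun (mu t) (p ^+ 2).
Hypothesis muS : forall t : R, 0 < t ->
  forall k, mu t k.+1 = (k%:R + 1 + al) * mu t k + c t * t ^+ k.+1.
Hypothesis mu_derive : forall t : R, 0 < t ->
  forall k, is_derive (fun s => mu s k) t (- c t * t ^+ k).
Local Notation P := (fun n s => ops (mu s) n).
Local Notation h := (fun n s => ops_norm (mu s) n).

Lemma locally_gt0 (t : R) : 0 < t -> locally t (fun s : R => 0 < s).
Proof. by move=> /RltP t_gt0; apply: filter_imp (near_pos t t_gt0) => s /RltP. Qed.

(** Product rule: the derivatives of the moments are those of a point mass -c at [t], which
    evaluates the polynomial there. *)
Lemma is_derive_lfun (p : R -> {poly R}) (dp : {poly R}) (t : R) N : 0 < t ->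
  (forall s, (size (p s) <= N)%N) -> is_poly_derive p t dp ->
  is_derive (fun s => lfun (mu s) (p s)) t (lfun (mu t) dp - c t * (p t).[t]).
Proof.
move=> t_gt0 szp hp.
apply: (is_derive_ext (fun s => \sum_(i < N) (p s)`_i * mu s i)) => [s|].
  by rewrite (lfunE _ (szp s)).
have -> : lfun (mu t) dp - c t * (p t).[t] =
    \sum_(i < N) (dp`_i * mu t i + (p t)`_i * (- c t * t ^+ i)).
  rewrite (lfunE _ (size_poly_derive szp hp)) (horner_coef_wide _ (szp t)) mulr_sumr -sumrB.
  by apply: eq_bigr => i _; ring.
apply: (is_derive_sum (f := fun i s => (p s)`_i * mu s i)
  (df := fun i => dp`_i * mu t i + (p t)`_i * (- c t * t ^+ i))) => i _.
by apply: is_deriveM; [exact: hp | exact: mu_derive].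
Qed.

Lemma size_ops n s : size (P n s) = n.+1.
Proof. exact: (ops_graded_monic (mu s) n).2. Qed.

Lemma size_opsM m n s : (size (P m s * P n s)%R <= m.+1 + n.+1)%N.
Proof. by rewrite (leq_trans (size_polyMleq _ _)) // !size_ops leq_pred. Qed.

(** Induction along the recurrence, carrying two consecutive indices: [ops_a] and [ops_b] are
    quotients of differentiable functionals by nonzero norms. *)
Lemma ex_derive_ops_coef n (t : R) : 0 < t -> forall i, ex_derive (fun s => (P n s)`_i) t.
Proof.
move=> t_gt0; pose D m := forall i, ex_derive (fun s => (P m s)`_i) t.
suff H : D n /\ D n.-1 by exact: H.1.
have pd m : D m -> exists dp, is_poly_derive (fun s => P m s) t dp.
  by move=> Dm; apply: (ex_poly_derive (N := m.+1) _ Dm) => s; rewrite size_ops.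
have hnz m : h m t != 0 by exact: (ops_norm_neq0 (mu_pos t_gt0)).
have exh m : D m -> ex_derive (h m) t.
  move=> /pd [dp hdp]; eexists.
  exact: (is_derive_lfun t_gt0 (size_opsM m m) (is_poly_deriveM hdp hdp)).
have hX : is_poly_derive (fun _ : R => 'X) t 0.
  by move=> i; rewrite coef0; exact: is_derive_const.
have exa m : D m -> ex_derive (fun s => ops_a (mu s) m) t.
  move=> Dm; have [[dh hdh] [dp hdp]] := (exh _ Dm, pd _ Dm).
  eexists; apply: is_derive_div (hnz m) _ hdh.
  apply: (is_derive_lfun (N := (m.+1 + m.+1).+1) t_gt0).
    by move=> s; rewrite (leq_trans (size_polyMleq _ _)) // size_polyX; exact: size_opsM.
  exact: is_poly_deriveM hX (is_poly_deriveM hdp hdp).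
have exb m : D m -> D m.-1 -> ex_derive (fun s => ops_b (mu s) m) t.
  case: m => [|m] Dm Dm1; first exact: ex_derive_const.
  have [[d1 hd1] [d2 hd2]] := (exh _ Dm, exh _ Dm1).
  by eexists; apply: is_derive_div hd1 hd2; exact: hnz.
elim: n => [|n [IHn IHn1]].
  by split=> i; apply: (ex_derive_ext (fun _ => (1 : {poly R})`_i : R)) => //; apply: ex_derive_const.
have [[da hda] [db hdb]] := (exa _ IHn, exb _ IHn IHn1).
split=> // i.
apply: (ex_derive_ext (fun s => ('X * P n s)`_i + (- 1) * (ops_a (mu s) n * (P n s)`_i)
    + (- 1) * (ops_b (mu s) n * (P n.-1 s)`_i))) => [s|].
  by rewrite ops_recurrence !coefD !coefZ; ring.
have hc (k x : R) : is_derive (fun _ : R => k : R) x (0 : R) by exact: is_derive_const.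
have [dX hdX] : ex_derive (fun s => ('X * P n s)`_i) t.
  apply: (ex_derive_ext (fun s => (if i is j.+1 then (P n s)`_j else 0) : R)) => [s|].
    by rewrite coefXM; case: i.
  by case: i => [|j]; [exact: ex_derive_const | exact: IHn].
have [[d1 h1] [d2 h2]] := (IHn i, IHn1 i).
eexists; apply: is_deriveD; first apply: is_deriveD; first exact: hdX.
  by apply: (is_deriveM (hc _ _)); apply: is_deriveM hda h1.
by apply: (is_deriveM (hc _ _)); apply: is_deriveM hdb h2.
Qed.

(** The leading coefficient is constantly 1, so differentiation lowers the degree. *)
Lemma ex_poly_derive_ops n (t : R) : 0 < t ->
  exists2 dP : {poly R}, (size dP <= n)%N & is_poly_derive (P n) t dP.
Proof.
move=> t_gt0; have szP s : (size (P n s) <= n.+1)%N by rewrite size_ops.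
have [dP hd] := ex_poly_derive szP (ex_derive_ops_coef n t_gt0).
exists dP => //; apply/leq_sizeP => j; rewrite leq_eqVlt => /orP [/eqP <- | lt_nj].
  rewrite -(is_derive_unique _ _ _ (hd n)); apply: is_derive_unique.
  apply: (is_derive_ext (fun _ : R => 1 : R)) => [s|]; last exact: is_derive_const.
  by rewrite (graded_monic_lead _ (ops_graded_monic _)).
by rewrite nth_default // (leq_trans (size_poly_derive szP hd)).
Qed.

(* The contribution of [dP_n/dt] vanishes, being of degree less than [n]. *)
Lemma is_derive_ops_norm n (t : R) : 0 < t ->
  is_derive (h n) t (- c t * (P n t).[t] ^+ 2).
Proof.
move=> t_gt0; have [dP szd hd] := ex_poly_derive_ops n t_gt0.
have gP := ops_graded_monic (mu t); have oP := ops_orth_lt (mu_pos t_gt0) (n := n).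
have := is_derive_lfun t_gt0 (size_opsM n n) (is_poly_deriveM hd hd).
rewrite lfunD [dP * _]mulrC (orthogonal_lower gP oP) // hornerM addr0 sub0r -mulNr -expr2.
exact.
Qed.

(* Differentiate [L_t (P_(n+1) P_n) = 0]. *)
Lemma is_derive_ops_subleading n (t : R) : 0 < t ->
  is_derive (fun s => ops_subleading (mu s) n) t (ops_r (mu t) (c t) t n / t).
Proof.
move=> t_gt0; case: n => [|n].
  by rewrite /ops_r /= mulr0 !mul0r; exact: is_derive_const.
have [dP szd hd] := ex_poly_derive_ops n.+1 t_gt0.
have [dQ szdQ hdQ] := ex_poly_derive_ops n t_gt0.
have gP := ops_graded_monic (mu t); have oP m := ops_orth_lt (mu_pos t_gt0) (n := m).
have hnz m : h m t != 0 by exact: (ops_norm_neq0 (mu_pos t_gt0)).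
have := is_derive_lfun t_gt0 (size_opsM n.+1 n) (is_poly_deriveM hd hdQ).
move/is_derive_unique.
have -> : Derive (fun s => lfun (mu s) (P n.+1 s * P n s)) t = 0.
  apply: is_derive_unique; apply: (is_derive_ext_loc (fun _ : R => 0 : R)).
    apply: filter_imp (locally_gt0 t_gt0) => s s_gt0.
    by rewrite (ops_orth_lt (mu_pos s_gt0)).
  exact: is_derive_const.
rewrite lfunD [dP * _]mulrC (orthogonal_top gP (oP n)) // (orthogonal_lower gP (oP n.+1)) ?leqW //.
rewrite hornerM addr0 => /esym/eqP; rewrite subr_eq0 => /eqP e.
have -> : ops_r (mu t) (c t) t n.+1 / t = dP`_n; last exact: hd.
apply: (mulIf (hnz n)); rewrite -[h n t]/(lfun (mu t) (P n t ^+ 2)) e.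
have hn := hnz n; have hn1 := hnz n.+1; have tn0 := lt0r_neq0 t_gt0.
by rewrite /ops_r /ops_b /=; field; rewrite hn hn1 tn0.
Qed.

Definition log_hankel n (s : R) : R := ln (\det (\matrix_(i < n, j < n) mu s (i + j)%N)).
(** For the moments of the jump weight this is convertible to [Hn]. *)
Definition hankel_H n (s : R) : R := (s * Derive (log_hankel n) s)%R.

(** Near [t] the determinant is a product of positive norms, and each ln h_j has derivative -R_j /
    t. *)
Lemma is_derive_log_hankel n (t : R) : 0 < t ->
  is_derive (log_hankel n) t (ops_H (mu t) (c t) t n / t).
Proof.
move=> t_gt0; have tn0 := lt0r_neq0 t_gt0.
apply: (is_derive_ext_loc (fun s => \sum_(j < n) ln (h j s))).
  apply: filter_imp (locally_gt0 t_gt0) => s s_gt0.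
  rewrite /log_hankel (det_hankel (mu_pos s_gt0)); elim: (n) => [|m IH].
    by rewrite !big_ord0 ln_1.
  rewrite !big_ord_recr /= IH; symmetry; apply: ln_mult; last exact/RltP/(ops_norm_gt0 (mu_pos s_gt0)).
  by apply/RltP/prodr_gt0 => i _; exact: (ops_norm_gt0 (mu_pos s_gt0)).
have -> : ops_H (mu t) (c t) t n / t =
    \sum_(j < n) (- c t * (P j t).[t] ^+ 2 * (h j t)^-1).
  rewrite /ops_H mulNr mulr_suml -sumrN; apply: eq_bigr => j _.
  by rewrite /ops_R; field; rewrite tn0 (ops_norm_neq0 (mu_pos t_gt0)).
apply: (is_derive_sum (f := fun j s => ln (h j s))
  (df := fun j => - c t * (P j t).[t] ^+ 2 * (h j t)^-1)) => j _.
apply: (is_derive_comp ln (h j)); last exact: is_derive_ops_norm.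
exact/is_derive_ln/RltP/(ops_norm_gt0 (mu_pos t_gt0)).
Qed.

Lemma hankel_HE n (t : R) : 0 < t -> hankel_H n t = ops_H (mu t) (c t) t n.
Proof.
move=> t_gt0; rewrite /hankel_H (is_derive_unique _ _ _ (is_derive_log_hankel n t_gt0)).
by rewrite mulrC divfK // lt0r_neq0.
Qed.

(** Near [t], H_n differs from the subleading coefficient by a constant. *)
Lemma is_derive_hankel_H n (t : R) : 0 < t ->
  is_derive (hankel_H n) t (ops_r (mu t) (c t) t n / t).
Proof.
move=> t_gt0.
apply: (is_derive_ext_loc (fun s => ops_subleading (mu s) n + n%:R * (n%:R + al))).
  apply: filter_imp (locally_gt0 t_gt0) => s s_gt0.
  by rewrite hankel_HE // (ops_subleadingE (mu_pos s_gt0) (muS s_gt0)) subrK.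
rewrite -[X in is_derive _ _ X]addr0; apply: is_deriveD; first exact: is_derive_ops_subleading.
exact: is_derive_const.
Qed.

Lemma is_derive_ops_b n (t : R) : 0 < t -> (0 < n)%N ->
  is_derive (fun s => ops_b (mu s) n) t
    (ops_b (mu t) n * (ops_R (mu t) (c t) t n.-1 - ops_R (mu t) (c t) t n) / t).
Proof.
case: n => // n t_gt0 _ /=; have tn0 := lt0r_neq0 t_gt0.
have hnz m : h m t != 0 by exact: (ops_norm_neq0 (mu_pos t_gt0)).
have := is_derive_div (hnz n) (is_derive_ops_norm n.+1 t_gt0) (is_derive_ops_norm n t_gt0).
set d := (X in is_derive _ _ X -> _); set d' := (X in _ -> is_derive _ _ X).
suff -> : d' = d by [].
by rewrite /d /d' /ops_R /ops_b; field; rewrite !hnz tn0.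
Qed.

(** Near [t] the first derivative is r_n(s)/s with r_n = H_n - n(n+al) + b_n. In the quotient rule t
    H_n' cancels r_n, leaving b_n' / t. *)
Lemma is_derive_Derive_hankel_H n (t : R) : 0 < t -> (0 < n)%N ->
  is_derive (Derive (hankel_H n)) t
    (ops_b (mu t) n * (ops_R (mu t) (c t) t n.-1 - ops_R (mu t) (c t) t n) / t ^+ 2).
Proof.
move=> t_gt0 n_gt0; have tn0 := lt0r_neq0 t_gt0.
have rE (s : R) : 0 < s -> ops_r (mu s) (c s) s n =
    hankel_H n s + (- (n%:R * (n%:R + al)) + ops_b (mu s) n).
  move=> s_gt0; rewrite (ops_rE (mu_pos s_gt0) (muS s_gt0)) hankel_HE //.
  by rewrite (ops_subleadingE (mu_pos s_gt0) (muS s_gt0)) addrA.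
apply: (is_derive_ext_loc (fun s => (hankel_H n s + (- (n%:R * (n%:R + al)) + ops_b (mu s) n)) / s)).
  apply: filter_imp (locally_gt0 t_gt0) => s s_gt0.
  by rewrite (is_derive_unique _ _ _ (is_derive_hankel_H n s_gt0)) rE.
have hc (k x : R) : is_derive (fun _ : R => k : R) x (0 : R) by exact: is_derive_const.
have hid : is_derive (fun s : R => s) t (1 : R) by exact: is_derive_id.
have := is_derive_div tn0 (is_deriveD (is_derive_hankel_H n t_gt0)
  (is_deriveD (hc (- (n%:R * (n%:R + al))) t) (is_derive_ops_b t_gt0 n_gt0))) hid.
rewrite -(rE t) //.
set d := (X in is_derive _ _ X -> _); set d' := (X in _ -> is_derive _ _ X).
suff -> : d' = d by [].
by rewrite /d /d' ?R0E ?R1E; field.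
Qed.

End Deformation.

(** * The Laguerre weight with a jump *)

Section LaguerreJump.
Local Open Scope ring_scope.
Variables (al A B : R).
Hypothesis al_gt0 : Rlt (IZR 0) al.

(** Convergence is proved together with the value, since integrals can be added only when they
    exist. This transfers the integral hypotheses on [P] to the algebraic functional. *)
Lemma is_RInt_gen_poly_weight (t : R) (p : {poly R}) : Rlt (IZR 0) t ->
  is_RInt_gen (fun x => p.[x] * weight al A B t x) (at_point (IZR 0)) (Rbar_locally p_infty)
    (lfun (moment al A B t) p).
Proof.
move=> t_gt0.
have pow_mom i := is_RInt_gen_pow_weight al A B t i al_gt0 t_gt0.
have fil0 := @filter_filter _ _ (at_point_filter (IZR 0)).
have filoo := @filter_filter _ _ (Rbar_locally_filter p_infty).
have mono i := @is_RInt_gen_scal _ _ _ fil0 filoo _ p`_i _ (pow_mom i).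
have step N : is_RInt_gen (fun x => (\sum_(i < N) p`_i * x ^+ i) * weight al A B t x)
    (at_point (IZR 0)) (Rbar_locally p_infty) (\sum_(i < N) p`_i * ((A + B) * complete_gamma al i - B * lower_gamma al i t)).
  elim: N => [|N IH].
    have := @is_RInt_gen_scal _ _ _ fil0 filoo _ (IZR 0) _ (mono 0%N).
    rewrite big_ord0 [X in is_RInt_gen _ _ _ X -> _]scal_zero_l.
    apply is_RInt_gen_ext; apply filter_forall => -[u v] x _.
    by rewrite big_ord0 mul0r; exact: Rmult_0_l.
  have := @is_RInt_gen_plus _ _ _ fil0 filoo _ _ _ _ IH (mono N); rewrite big_ord_recr.
  apply is_RInt_gen_ext; apply filter_forall => -[u v] x _.
  by rewrite big_ord_recr /= mulrDl -mulrA -RpowE.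
have -> : lfun (moment al A B t) p =
    \sum_(i < size p) p`_i * ((A + B) * complete_gamma al i - B * lower_gamma al i t).
  by apply: eq_bigr => i _; rewrite momentE.
have := step (size p); apply is_RInt_gen_ext.
by apply filter_forall => -[u v] x _; rewrite horner_coef.
Qed.

Lemma int0inf_poly_weight (t : R) (p : {poly R}) : Rlt (IZR 0) t ->
  int0inf (fun x => p.[x] * weight al A B t x) = lfun (moment al A B t) p.
Proof. by move=> t_gt0; apply is_RInt_gen_unique, is_RInt_gen_poly_weight. Qed.

Lemma monotone_of_derive (f df : R -> R) (a b : R) : Rle (IZR 0) a -> Rle a b ->
  (forall x, is_derive f x (df x)) -> (forall x, Rle (IZR 0) x -> Rle (IZR 0) (df x)) ->
  Rle (f a) (f b).
Proof.
move=> a_ge0 leab hf df_ge0.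
have [x _ | x _ | d [[h1 _] e]] := MVT_gen f a b df; first exact: hf.
  by apply: derivable_continuous_pt; apply: ex_derive_Reals_0; eexists; exact: hf.
rewrite Rmin_left // in h1.
have := Rmult_le_pos _ _ (df_ge0 d (Rle_trans _ _ _ a_ge0 h1)) (proj1 (Rminus_le_0 a b) leab).
by rewrite -e => /(proj2 (Rminus_le_0 _ _)).
Qed.

Hypotheses (A_ge0 : Rle (IZR 0) A) (B_gt0 : Rlt (IZR 0) B).

(** With [G] the primitive of p^2 x^al e^(-x) and [Lam] its limit, the functional is A Lam + B (Lam
    - G(t)). If this were not positive, [G] would be constant beyond [t] and [p] would vanish
    there. *)
Lemma lfun_moment_pos (t : R) (p : {poly R}) : Rlt (IZR 0) t -> p != 0 ->
  Rlt (IZR 0) (lfun (moment al A B t) (p ^+ 2)).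
Proof.
move=> t_gt0 p_neq0; set q := p ^+ 2; set N := size q.
pose G x := \sum_(i < N) q`_i * lower_gamma al i x.
pose g x := q.[x] * gamma_density al 0 x.
pose Lam := \sum_(i < N) q`_i * complete_gamma al i.
have G_derive x : is_derive G x (g x).
  have -> : g x = \sum_(i < N) q`_i * gamma_density al i x.
    rewrite /g horner_coef mulr_suml; apply: eq_bigr => i _.
    by rewrite -mulrA /gamma_density /= RpowE Rmult_1_l.
  apply: (is_derive_sum (f := fun i x => q`_i * lower_gamma al i x)
     (df := fun i => q`_i * gamma_density al i x)) => i _.
  by apply: is_derive_scal; exact: is_derive_lower_gamma.
have g_ge0 x : Rle (IZR 0) x -> Rle (IZR 0) (g x).
  move=> x_ge0; apply: Rmult_le_pos; last exact: gamma_density_ge0.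
  by apply/RleP; rewrite /q horner_exp sqr_ge0.
have G_incr a b : Rle (IZR 0) a -> Rle a b -> Rle (G a) (G b).
  by move=> a_ge0 leab; exact: (monotone_of_derive G g).
have G_lim : is_lim G p_infty Lam.
  rewrite /G /Lam; elim: (N) => [|n IH].
    rewrite big_ord0; apply: (is_lim_ext (fun _ => 0)) => [x|]; first by rewrite big_ord0.
    exact: is_lim_const.
  rewrite big_ord_recr; apply: (is_lim_ext (fun x => \sum_(i < n) q`_i * lower_gamma al i x
     + q`_n * lower_gamma al n x)) => [x|]; first by rewrite big_ord_recr.
  apply: is_lim_plus' => //.
  by apply: (is_lim_scal_l _ q`_n p_infty (complete_gamma al n)); exact: is_lim_lower_gamma.
have G_le x : Rle (IZR 0) x -> Rle (G x) Lam.
  move=> x_ge0; apply: (is_lim_le_loc (fun _ => G x) G p_infty (G x) Lam) => //.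
    by exists x => y ltxy; apply: G_incr => //; exact: Rlt_le.
  exact: is_lim_const.
have LE : lfun (moment al A B t) q = Rminus (Rmult (Rplus A B) Lam) (Rmult B (G t)).
  have -> : Rminus (Rmult (Rplus A B) Lam) (Rmult B (G t)) = (A + B) * Lam - B * G t by [].
  rewrite /lfun -/N /Lam /G !mulr_sumr -sumrB; apply: eq_bigr => i _.
  by rewrite momentE // mulrBr !mulrA ![q`_i * _]mulrC.
have G0 : G (IZR 0) = IZR 0.
  rewrite /G big1 // => i _.
  by rewrite /lower_gamma RInt_point mulr0.
have t_ge0 := Rlt_le _ _ t_gt0.
have Gt_ge0 := G_incr _ _ (Rle_refl _) t_ge0; rewrite G0 in Gt_ge0.
have Gt_le := G_le t t_ge0.
apply: Rnot_le_lt => L_le0; rewrite LE in L_le0.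
(* Both summands are nonnegative and B > 0, so a nonpositive total forces Lam <= G(t). *)
have LamG : Lam = G t by apply: Rle_antisym => //; nra.
have G_const x : Rlt t x -> G x = G t.
  move=> lttx; apply: Rle_antisym; last by apply: G_incr => //; exact: Rlt_le.
  by rewrite -LamG; apply: G_le; lra.
have p_root x : Rlt t x -> p.[x] = 0.
  move=> lttx; have : g x = IZR 0.
    rewrite -(is_derive_unique _ _ _ (G_derive x)); apply: is_derive_unique.
    apply: (is_derive_ext_loc (fun _ : R => G t)); last exact: is_derive_const.
    by apply: filter_imp (open_gt t x lttx) => y ltty; rewrite G_const.
  have gd_neq0 : gamma_density al 0 x <> IZR 0.
    rewrite gamma_densityE; last lra.
    by apply: Rgt_not_eq; exact: exp_pos.
  move=> /Rmult_integral [|//]; rewrite /q horner_exp => /eqP.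
  by rewrite expf_eq0 /= => /eqP.
(* [p] vanishes on all of [(t, +oo)], in particular at [t + 1], ..., [t + size p]. *)
case/negP: p_neq0; apply/eqP.
apply: (@roots_geq_poly_eq0 _ p [seq t + i.+1%:R | i <- iota 0 (size p)]).
- apply/allP => _ /mapP [i _ ->]; apply/rootP/p_root/RltP.
  by rewrite ltrDl ltr0Sn.
- rewrite map_inj_uniq ?iota_uniq // => i j /addrI /eqP.
  by rewrite eqr_nat eqSS => /eqP.
- by rewrite size_map size_iota.
Qed.

End LaguerreJump.

Theorem theorem8 (al A B t : R) (P : nat -> {poly R}) (a b : nat -> R) (n : nat) :
  0 < al -> 0 <= A -> 0 < B -> 0 < t ->
  monic_OPS al A B t P -> three_term P a b -> (1 <= n)%N ->
  let H := Hn al A B in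
  let N := INR n in
  let H0 := H n t in
  let H1 := Derive (H n) t in
  let H2 := Derive (Derive (H n)) t in
  let Hp := H n.+1 t in
  let Hm := H n.-1 t in
  (2 * (H0 - N * (N + al) - t * H1) <> 0 ->
     a n - (2 * N + al + 1) =
     (t ^ 2 * H2 + ((2 * N + al) * t - t ^ 2) * H1 + t * H0)
       / (2 * (H0 - N * (N + al) - t * H1))) /\
  b n - N * (N + al) = t * H1 - H0 /\
  (t * H2) ^ 2 = 4 * H1 ^ 2 * (H0 - N * (N + al) - t * H1)
                 + ((2 * N + al - t) * H1 + H0) ^ 2 /\
  a n - (2 * N + al + 1) = H0 - Hp /\
  (t + Hp - Hm - 2 * N - al <> 0 ->
     b n - N * (N + al) =
     (H0 * (2 * N + al) - N * (N + al) * (Hp - Hm)) / (t + Hp - Hm - 2 * N - al)) /\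
  (t + Hp - Hm - 2 * N - al <> 0 ->
     (((H0 - N * (N + al)) * (t + Hp - Hm) + t * N * (N + al))
        / (t + Hp - Hm - 2 * N - al)) ^ 2 =
     (((2 * N + al) * (H0 - N * (N + al)) + t * N * (N + al))
        / (t + Hp - Hm - 2 * N - al)) * (H0 - Hp) * (Hm - H0)).
Proof.
move=> al_gt0 A_ge0 B_gt0 t_gt0 [gP oP] tt n_gt0.
pose mu s := moment al A B s; pose c := jump al B.
have mu_pos (s : R) : (0 < s)%R -> forall p : {poly R}, p != 0%R -> (0 < lfun (mu s) (p ^+ 2))%R.
  by move=> /RltP s_gt0 p p0; apply/RltP; exact: lfun_moment_pos.
have muS (s : R) : (0 < s)%R -> forall k, mu s k.+1 = ((k%:R + 1 + al) * mu s k + c s * s ^+ k.+1)%R.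
  by move=> /RltP s_gt0 k; rewrite /mu momentS // -RpowE -INRE.
have mu_der (s : R) : (0 < s)%R -> forall k, is_derive (fun s => mu s k) s (- c s * s ^+ k)%R.
  by move=> /RltP s_gt0 k; rewrite -RpowE; exact: is_derive_moment.
have tpos : (0 < t)%R by apply/RltP.
have oP' : orthogonal (mu t) P.
  move=> i j ne_ij; rewrite -(int0inf_poly_weight al A B al_gt0 t) // -[RHS](oP i j ne_ij).
  by congr int0inf; apply: FunctionalExtensionality.functional_extensionality => x; rewrite hornerM.
(* By uniqueness the given polynomials are the constructed ones at this [t], so their recurrence
   coefficients agree as well. *)
have PE k : P k = ops (mu t) k.
  by apply: (orthogonal_unique (mu_pos t tpos)) => //; [exact: ops_graded_monic | exact: (ops_orthogonal (mu_pos t tpos))].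
have [aE bE] : a n = ops_a (mu t) n /\ b n = ops_b (mu t) n.
  apply: (recurrence_unique (mu_pos t tpos) gP oP' n_gt0).
  have := tt n n_gt0; rewrite !PE (ops_recurrence (mu t) n) -!addrA => /addrI.
  by move=> <-.
have Hfun k : Hn al A B k = hankel_H mu k by [].
cbv zeta; rewrite !Hfun.
have HH k := hankel_HE mu_pos mu_der k tpos.
have H1E := is_derive_unique _ _ _ (is_derive_hankel_H mu_pos muS mu_der n tpos).
have H2E := is_derive_unique _ _ _ (is_derive_Derive_hankel_H mu_pos muS mu_der tpos n_gt0).
have t0 : t <> 0 by lra.
have t0' : t != 0%R by apply/eqP.
apply: (@ladder_elimination _ _ _ _ _ _ _ _ _ _ (ops_R (mu t) (c t) t n) (ops_R (mu t) (c t) t n.-1) (ops_r (mu t) (c t) t n)) => //.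
- have cancel X : (t * (X / t))%R = X by rewrite mulrC divfK.
  by rewrite H1E; symmetry; exact: cancel.
- have cancel X : (t * (t * (X / t ^+ 2)))%R = X by rewrite mulrA -expr2 mulrC divfK // expf_neq0.
  by rewrite H2E bE; exact: cancel.
- by rewrite aE (ops_aE (mu_pos t tpos) (muS t tpos)) INRE.
- rewrite bE HH (ops_rE (mu_pos t tpos) (muS t tpos)) (ops_subleadingE (mu_pos t tpos) (muS t tpos)) -INRE.
  have cancel (x y z : R) : z = (x - y + z - x + y)%R by ring.
  exact: cancel.
- by rewrite bE RpowE (ops_r_sqr _ _ (mu_pos t tpos)).
- by rewrite bE HH INRE; exact: (ops_bR_sum (mu_pos t tpos) (muS t tpos)).
- by rewrite !HH /ops_H big_ord_recr /= opprD.
(* As n >= 1, write n = m + 1: the last term of the sum for H_n is R_m = R_(n-1). *)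
- rewrite !HH /ops_H; case: (n) n_gt0 => // m _.
  by rewrite big_ord_recr /= opprD; symmetry; exact: subrK.
Qed.
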